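(* Let $\mathbf{t}=T(\mathbf{f})$ be the ternary word obtained from the Fibonacci word $\mathbf{f}$ by replacing every second occurrence of $0$, starting with the second one, by $2$. Then $\mathbf{t}$ does not have the Frobenius property.
   Context: Let $\varphi=(1+\sqrt5)/2$ and $\alpha=2-\varphi$. The Fibonacci word is $\mathbf{f}=(\lfloor (n+1)\alpha\rfloor-\lfloor n\alpha\rfloor)_{n\ge1}=01001010010010100\cdots$ over $\{0,1\}$. $T$ keeps each $1$, and among the occurrences of $0$ (in order) keeps the 1st, 3rd, 5th, $\dots$ as $0$ and replaces the 2nd, 4th, 6th, $\dots$ by $2$; thus $\mathbf{t}=01201210210210120\cdots$. For an infinite word $\mathbf{w}$, $\mathcal{L}_{\mathbf{w}}$ is its set of factors. A semigroup homomorphism $S:\{0,1,2\}^*\to\mathbb{N}$ is determined by $S(0),S(1),S(2)$ via $S(uv)=S(u)+S(v)$, and $S(\mathcal{L}_{\mathbf{w}})=\{S(u):u\in\mathcal{L}_{\mathbf{w}}\}$. A ternary infinite word $\mathbf{w}$ has the Frobenius property if for every such $S$ with $S(0),S(1),S(2)$ non-negative integers and $\gcd(S(0),S(1),S(2))=1$, the set $S(\mathcal{L}_{\mathbf{w}})$ contains all but finitely many elements of $\mathbb{N}$. *)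

(* Defs.v *)
From mathcomp Require Import all_boot all_order all_algebra.
From mathcomp Require Import all_classical reals.
From mathcomp Require Import ring lra.
Set Implicit Arguments. Unset Strict Implicit. Unset Printing Implicit Defensive.
Import Order.TTheory GRing.Theory Num.Theory.
Local Open Scope classical_set_scope.
Local Open Scope ring_scope.

(* An infinite word w_1 w_2 ... over A is the function n |-> w_(n+1). *)
Definition infinite_word (A : Type) := nat -> A.

Definition golden_ratio (R : realType) : R := (1 + Num.sqrt 5) / 2.

Definition fib_slope (R : realType) : R := 2 - golden_ratio R.

Definition fib_diff (R : realType) (n : nat) : int :=
  Num.floor (n.+1%:R * fib_slope R) - Num.floor (n%:R * fib_slope R).

(* The letters start at index 1 in the formula, hence fib_diff at n.+1.
   The truncations performed by `|_| and inord are never effective: see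
   fib_wordE below. *)
Definition fib_word (R : realType) : infinite_word 'I_2 :=
  fun n => inord `|fib_diff R n.+1|%N.

Lemma fib_slope_bounds (R : realType) : 0 < fib_slope R < 1.
Proof.
have h5 : Num.sqrt 5 * Num.sqrt 5 = 5 :> R by rewrite -expr2 sqr_sqrtr.
have h0 : 0 <= Num.sqrt 5 :> R by exact: sqrtr_ge0.
rewrite /fib_slope /golden_ratio; apply/andP; split; nra.
Qed.

Lemma fib_wordE (R : realType) (n : nat) :
  (fib_word R n : nat)%:Z = fib_diff R n.+1.
Proof.
have [d0 d1] : 0 <= fib_diff R n.+1 /\ fib_diff R n.+1 < 2.
  have /andP[a0 a1] := fib_slope_bounds R.
  rewrite /fib_diff -[in X in Num.floor X - _]natr1 mulrDl mul1r.
  set x := n.+1%:R * _; set a := fib_slope R in a0 a1 *.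
  have /andP[u0 u1] := floor_itv (x + a).
  have /andP[v0 v1] := floor_itv x.
  split.
    rewrite subr_ge0 -ltzD1 -(ltr_int R).
    by apply: le_lt_trans v0 (lt_trans _ u1); rewrite ltrDl.
  rewrite -(ltr_int R); move: v1; rewrite !rmorphB !rmorphD /= => v1; lra.
rewrite /fib_word inordK; first by rewrite gez0_abs.
by rewrite -ltz_nat gez0_abs.
Qed.

(* 0, 1, 2 : 'I_3 are the three letters.  The occurrence of 0 at position n is
   replaced by 2 when the number of earlier occurrences of 0 is odd. *)
Definition T (w : infinite_word 'I_2) : infinite_word 'I_3 :=
  fun n => if w n == 1 then 1
           else if odd (count (fun i => w i == 0) (iota 0 n)) then 2 else 0.

Definition factors (A : Type) (w : infinite_word A) : set (seq A) :=
  [set u | exists i n, u = mkseq (fun k => w (i + k)%N) n].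

Definition semigroup_hom (S : seq 'I_3 -> nat) : Prop :=
  {morph S : u v / u ++ v >-> (u + v)%N}.

Definition frobenius_property (w : infinite_word 'I_3) : Prop :=
  forall S : seq 'I_3 -> nat, semigroup_hom S ->
    gcdn (gcdn (S [:: 0]) (S [:: 1])) (S [:: 2]) = 1%N ->
    cofinite_set (S @` factors w).

(* Main.v *)
Require Import Defs.
From mathcomp Require Import all_boot all_order all_algebra.
From mathcomp Require Import all_classical reals.
From mathcomp Require Import zify.

(* Only the alternation of 0 and 2 in T w matters.  Give the letters 0, 1, 2
   the weights 2, 0, 3.  A prefix of T w has weight 0 or 2 modulo 5, according
   to the parity of its number of non-1 letters.  A factor is the difference of
   two prefixes, so its weight is 0, 2 or 3 modulo 5, and no number congruent
   to 1 modulo 5 is attained. *)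

Local Open Scope classical_set_scope.
Local Open Scope ring_scope.

Definition letter_weight (x : 'I_3) : nat :=
  if x == 0 then 2 else if x == 1 then 0 else 3.

Definition weight (u : seq 'I_3) : nat := (\sum_(x <- u) letter_weight x)%N.

Lemma weight_cat u v : weight (u ++ v) = (weight u + weight v)%N.
Proof. by rewrite /weight big_cat. Qed.

Lemma weight_prefix_mod5 (w : infinite_word 'I_2) (n : nat) :
  (weight (mkseq (T w) n) =
     2 * odd (count (fun i => w i == 0%R) (iota 0 n)) %[mod 5])%N.
Proof.
elim: n => [|n IHn]; first by rewrite /weight big_nil.
rewrite mkseqS -cats1 weight_cat -modnDml IHn modnDml.
rewrite -[in iota _ n.+1]addn1 iotaD count_cat /= add0n addn0 oddD.
rewrite /weight big_seq1 /T.
(* A letter 0 of [w] flips the parity: it adds 2 to residue 0, or 3 to residue 2, which wraps to 0.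
   A letter 1 changes nothing. *)
case: (w n) => [[|[|//]]] lt_wn /=; first by case: odd.
by rewrite addbF addn0.
Qed.

Lemma weight_factor_mod5 (w : infinite_word 'I_2) (u : seq 'I_3) :
  factors (T w) u -> (weight u %% 5 != 1)%N.
Proof.
move=> [i [n ->]].
have : (weight (mkseq (T w) (i + n)) =
        weight (mkseq (T w) i) + weight (mkseq (fun k => T w (i + k)) n))%N.
  rewrite -weight_cat /mkseq iotaD map_cat add0n.
  by rewrite -{2}[i]addn0 iotaDl -map_comp.
have := weight_prefix_mod5 w i; have := weight_prefix_mod5 w (i + n).
by case: odd; case: odd; lia.
Qed.

Lemma T_not_frobenius (w : infinite_word 'I_2) : ~ frobenius_property (T w).
Proof.
(* The gcd of 2, 0 and 3 computes to 1. *)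
move=> /(_ weight weight_cat); rewrite /weight !big_seq1 => /(_ erefl) cof.
apply: infinite_nat.
(* Pulled back along the injection [k |-> 5 * k + 1], the finite set of missed values would be
   finite, yet it is all of [nat]. *)
have inj : {in (fun k => 5 * k + 1)%N @^-1` ~` (weight @` factors (T w)) &,
            injective (fun k => 5 * k + 1)%N} by move=> j k _ _; lia.
apply: sub_finite_set (finite_preimage inj cof) => k _ [u /weight_factor_mod5].
lia.
Qed.

Theorem theorem18 (R : realType) : ~ frobenius_property (T (fib_word R)).
Proof. exact: T_not_frobenius. Qed.
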